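(* The category $\mathsf{ISpace_{\Box}}$ of descriptive $\Box$-frames and general $\Box$-frame morphisms is isomorphic to $\mathsf{Dialg}(\mathsf{I},\mathsf{V})$, where $\mathsf{I}:\mathsf{ISpace}\to\mathsf{MSpace}$ is the inclusion functor.
   Context: An M-space is $(X,\wedge,\top,\tau)$ with a meet-semilattice with top and a Stone topology generated by clopen filters and their complements; $\mathsf{MSpace}$ has continuous semilattice homomorphisms. With $x\leq y$ iff $x\wedge y=x$ and $a\Rightarrow b=\{x\mid\forall y\geq x,\ y\in a\Rightarrow y\in b\}$, an I-space is an M-space whose clopen filters are closed under $\Rightarrow$; $\mathsf{ISpace}$ has continuous semilattice homomorphisms $f$ that are bounded ($f(x)\leq y'$ implies $\exists y\geq x$, $f(y)=y'$). For an I-space $\mathbb{X}$, $\mathsf{V}\mathbb{X}$ is the M-space of closed filters (intersections of the clopen filters containing them) ordered by reverse inclusion, top $\{\top\}$, meet $c\sqcap c'=\bigcap\{a\text{ clopen filter}\mid c\cup c'\subseteq a\}$, topology generated by $\{c\mid c\subseteq a\}$ ($a$ clopen filter) and $\{c\mid c\cap b\neq\emptyset\}$ ($b$ clopen prime downset); on morphisms $\mathsf{V}h(c)=h[c]$. $\mathsf{Dialg}(\mathsf{I},\mathsf{V})$: objects $(\mathbb{X},\gamma)$ with $\gamma:\mathbb{X}\to\mathsf{V}\mathbb{X}$ an $\mathsf{MSpace}$-morphism; morphisms are I-space morphisms $f$ with $\mathsf{V}f\circ\gamma=\gamma'\circ f$. An I-frame is an implicative meet-semilattice with top viewed as poset.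 A $\Box$-frame is $(X,\leq,R)$, $(X,\leq)$ an I-frame, with (B1) $\top Rx$ iff $x=\top$, and $xR\top$ for all $x$; (B2) $xRy\leq z\Rightarrow xRz$; (B3) $xRy,x'Ry'\Rightarrow(x\wedge x')R(y\wedge y')$; (B4) $(x\wedge x')Rz\Rightarrow\exists y,y'$ with $xRy,x'Ry'$, $y\wedge y'=z$. A descriptive I-frame is $(X,\leq,A)$, $A$ a set of filters closed under $\cap,\Rightarrow$, differentiated and compact (every cover by members of $A$ and their complements has a finite subcover). A general $\Box$-frame is $(X,\leq,R,A)$ with $(X,\leq,R)$ a $\Box$-frame, $(X,\leq,A)$ a descriptive I-frame and $A$ closed under $p\mapsto\{x\mid R[x]\subseteq p\}$ where $R[x]=\{y\mid xRy\}$; it is descriptive if also $R[x]=\bigcap\{a\in A\mid R[x]\subseteq a\}$ for all $x$. A general $\Box$-frame morphism is a map that is a finite-meet-preserving map, bounded for $\leq$ and for $R$ ($xRy\Rightarrow h(x)R'h(y)$; $h(x)R'y'\Rightarrow\exists y$, $xRy$, $h(y)=y'$), with preimages of admissible filters admissible. Descriptive I-frames are identified with I-spaces by taking the topology generated by $A$ and complements of members of $A$. *)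

(* Defs.v *)
From HB Require Import structures.
From mathcomp Require Import all_boot all_order finmap.
From mathcomp Require Import all_classical topology.

Set Implicit Arguments.
Unset Strict Implicit.
Unset Printing Implicit Defensive.

Import Order.TTheory.

Local Open Scope classical_set_scope.

Record category := Category {
  obj :> Type;
  hom : obj -> obj -> Type;
  idm : forall X, hom X X;
  compm : forall X Y Z, hom Y Z -> hom X Y -> hom X Z;
  compm1 : forall X Y (f : hom X Y), compm f (idm X) = f;
  comp1m : forall X Y (f : hom X Y), compm (idm Y) f = f;
  compmA : forall X Y Z W (h : hom Z W) (g : hom Y Z) (f : hom X Y),
    compm h (compm g f) = compm (compm h g) f }.

Arguments hom {c}.
Arguments idm {c}.
Arguments compm {c X Y Z}.

Record functor (C D : category) := Functor {
  fobj :> C -> D;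
  fmap : forall X Y, hom X Y -> hom (fobj X) (fobj Y);
  fmap1 : forall X, fmap (idm X) = idm (fobj X);
  fmapM : forall X Y Z (g : hom Y Z) (f : hom X Y),
    fmap (compm g f) = compm (fmap g) (fmap f) }.

Arguments fmap {C D} F {X Y} : rename.

Definition functor_id (C : category) : functor C C :=
  @Functor C C id (fun _ _ f => f) (fun _ => erefl) (fun _ _ _ _ _ => erefl).

Section functor_comp.
Variables (C D E : category) (G : functor D E) (F : functor C D).

Fact functor_comp1 X : fmap G (fmap F (idm X)) = idm (G (F X)).
Proof. by rewrite !fmap1. Qed.

Fact functor_compM X Y Z (g : hom Y Z) (f : hom X Y) :
  fmap G (fmap F (compm g f)) = compm (fmap G (fmap F g)) (fmap G (fmap F f)).
Proof. by rewrite !fmapM. Qed.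

Definition functor_comp : functor C E :=
  @Functor C E (fun X => G (F X)) (fun _ _ f => fmap G (fmap F f))
    functor_comp1 functor_compM.

End functor_comp.

Definition isomorphic_categories (C D : category) :=
  exists (F : functor C D) (G : functor D C),
    functor_comp G F = functor_id C /\ functor_comp F G = functor_id D.

Section dialgebra.
Variables (C D : category) (F G : functor C D).

Record dialgebra := Dialgebra {
  dialg_obj :> C;
  dialg_str : hom (F dialg_obj) (G dialg_obj) }.

Definition dialg_hom (X Y : dialgebra) :=
  {f : hom (X : C) (Y : C) |
    compm (fmap G f) (dialg_str X) = compm (dialg_str Y) (fmap F f)}.

Fact dialg_idP (X : dialgebra) :
  compm (fmap G (idm (X : C))) (dialg_str X)
  = compm (dialg_str X) (fmap F (idm (X : C))).
Proof. by rewrite !fmap1 comp1m compm1. Qed.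

Fact dialg_compP (X Y Z : dialgebra) (g : dialg_hom Y Z) (f : dialg_hom X Y) :
  compm (fmap G (compm (sval g) (sval f))) (dialg_str X)
  = compm (dialg_str Z) (fmap F (compm (sval g) (sval f))).
Proof.
case: g f => [g gP] [f fP] /=.
by rewrite !fmapM -compmA fP compmA gP compmA.
Qed.

Definition dialg_id (X : dialgebra) : dialg_hom X X := exist _ _ (dialg_idP X).

Definition dialg_comp (X Y Z : dialgebra)
    (g : dialg_hom Y Z) (f : dialg_hom X Y) : dialg_hom X Z :=
  exist _ _ (dialg_compP g f).

Fact dialg_comp1 X Y (f : dialg_hom X Y) : dialg_comp f (dialg_id X) = f.
Proof. by case: f => f fP; apply/eq_exist/compm1. Qed.

Fact dialg_1comp X Y (f : dialg_hom X Y) : dialg_comp (dialg_id Y) f = f.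
Proof. by case: f => f fP; apply/eq_exist/comp1m. Qed.

Fact dialg_compA X Y Z W (h : dialg_hom Z W) (g : dialg_hom Y Z)
    (f : dialg_hom X Y) :
  dialg_comp h (dialg_comp g f) = dialg_comp (dialg_comp h g) f.
Proof. by case: h g f => [h hP] [g gP] [f fP]; apply/eq_exist/compmA. Qed.

Definition Dialg : category := Category dialg_comp1 dialg_1comp dialg_compA.

End dialgebra.

Section semilattice.
Context {d : Order.disp_t} {L : tMeetSemilatticeType d}.
Implicit Types (a b : set L) (x y : L).
Local Open Scope order_scope.

(* The topology library uses the word "filter" for filters of sets, hence the
   names below. *)
Definition meet_filter a :=
  [/\ a !=set0, forall x y, x <= y -> a x -> a y
    & forall x y, a x -> a y -> a (x `&` y)].

Definition prime_downset b :=
  [/\ b <> setT, forall x y, x <= y -> b y -> b x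
    & forall x y, b (x `&` y) -> b x \/ b y].

Definition set_imp a b := [set x : L | forall y, x <= y -> a y -> b y].

(* The relative pseudo-complement is unique, so its existence is a property of
   the order. *)
Definition implicative :=
  forall x y : L, exists z, forall w, (w <= z) = (w `&` x <= y).

Lemma meet_filter_top a : meet_filter a -> a \top.
Proof. by move=> [[x ax] aU _]; apply: aU ax; exact: lex1. Qed.

Lemma meet_filterT : meet_filter [set: L].
Proof. by split=> //; exists \top. Qed.

Lemma meet_filter1 : meet_filter [set \top : L].
Proof.
split; first by exists \top.
  by move=> x y /[swap] -> /=; rewrite le1x => /eqP.
by move=> x y -> ->; rewrite /= meetxx.
Qed.

Lemma meet_filterI a b : meet_filter a -> meet_filter b ->
  meet_filter (a `&` b)%classic.
Proof.
move=> fa fb; split; first by exists \top; split; exact: meet_filter_top.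
  case: fa fb => [_ aU _] [_ bU _] x y xy [ax bx].
  by split; [exact: aU ax|exact: bU bx].
case: fa fb => [_ _ aM] [_ _ bM] x y [ax bx] [ay byy].
by split; [exact: aM|exact: bM].
Qed.

Lemma meet_filter_bigcap (F : set (set L)) : F `<=` meet_filter ->
  meet_filter (\bigcap_(a in F) a).
Proof.
move=> FF; split; first by exists \top => a /FF /meet_filter_top.
  by move=> x y xy ax a Fa; have [_ aU _] := FF _ Fa; apply: aU xy _; exact: ax.
by move=> x y ax ay a Fa; have [_ _ aM] := FF _ Fa; apply: aM; [exact: ax|exact: ay].
Qed.

Lemma prime_downsetC b : prime_downset b -> meet_filter (~` b)%classic.
Proof.
move=> [bT bD bP]; split.
- by apply: contrapT => bC; apply: bT; apply/seteqP; split=> // x _;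
    apply: contrapT => nbx; apply: bC; exists x.
- by move=> x y xy nbx byy; apply: nbx; exact: bD xy byy.
- by move=> x y nbx nby /bP[].
Qed.

End semilattice.

Arguments implicative {d} L.

Section semilattice_hom.
Context {d : Order.disp_t} {L M : tMeetSemilatticeType d}.
Local Open Scope order_scope.

Definition meet_hom (f : L -> M) :=
  f \top = \top /\ {morph f : x y / x `&` y}.

Definition bounded_hom (f : L -> M) :=
  forall x y', f x <= y' -> exists2 y, x <= y & f y = y'.

Lemma meet_hom_le (f : L -> M) : meet_hom f -> {homo f : x y / x <= y}.
Proof. by move=> [_ fI] x y /meet_idPl xy; apply/meet_idPl; rewrite -fI xy. Qed.

Lemma meet_filter_preimage (f : L -> M) (a : set M) :
  meet_hom f -> meet_filter a -> meet_filter (f @^-1` a).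
Proof.
move=> fh fa; have [_ aU aM] := fa; split.
- by exists \top; rewrite /= fh.1; exact: meet_filter_top.
- by move=> x y xy; apply: aU; exact: meet_hom_le.
- by move=> x y ax ay; rewrite /= fh.2; exact: aM.
Qed.

Lemma prime_downset_preimage (f : L -> M) (b : set M) :
  meet_hom f -> prime_downset b -> prime_downset (f @^-1` b).
Proof.
move=> fh [bT bD bP]; split.
- move=> e; have : (f @^-1` b) \top by rewrite e.
  rewrite /= fh.1 => btop; apply: bT; apply/seteqP; split=> // y _.
  by apply: bD btop; exact: lex1.
- by move=> x y xy; apply: bD; exact: meet_hom_le.
- by move=> x y; rewrite /= fh.2 => /bP.
Qed.

Lemma meet_filter_image (f : L -> M) (a : set L) :
  meet_hom f -> bounded_hom f -> meet_filter a -> meet_filter (f @` a).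
Proof.
move=> fh fb fa; have [_ aU aM] := fa; split.
- by exists (f \top), \top => //; exact: meet_filter_top.
- by move=> x' y' + [x ax xx']; rewrite -xx' => /fb[y xy <-]; exists y => //;
    exact: aU ax.
- move=> x' y' [x ax <-] [y ay <-]; exists (x `&` y); first exact: aM.
  exact: fh.2.
Qed.

End semilattice_hom.

Lemma meet_hom_id d (L : tMeetSemilatticeType d) : meet_hom (@id L).
Proof. by []. Qed.

Lemma meet_hom_comp d (L M N : tMeetSemilatticeType d)
    (g : M -> N) (f : L -> M) :
  meet_hom g -> meet_hom f -> meet_hom (g \o f).
Proof.
move=> [g1 gI] [f1 fI]; split; first by rewrite /= f1.
by move=> x y /=; rewrite fI gI.
Qed.

Lemma bounded_hom_id d (L : tMeetSemilatticeType d) : bounded_hom (@id L).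
Proof. by move=> x y xy; exists y. Qed.

Lemma bounded_hom_comp d (L M N : tMeetSemilatticeType d)
    (g : M -> N) (f : L -> M) :
  bounded_hom g -> bounded_hom f -> bounded_hom (g \o f).
Proof.
by move=> gb fb x z /gb[y /fb[w xw <-] <-]; exists w.
Qed.

Section generated_open.
Context {T : choiceType}.
Implicit Types S : set (set T).

Definition generated_open S : set (set T) :=
  [set \bigcup_(U in F) U | F in [set F | F `<=` finI_from S id]].

Lemma generated_openP S U : generated_open S U <->
  forall x, U x -> exists V, [/\ finI_from S id V, V x & V `<=` U].
Proof.
split=> [[F FS <-] x [V FV Vx]|US].
  by exists V; split=> //; [exact: FS|exact: bigcup_sup].
exists [set V | finI_from S id V /\ V `<=` U]; first by move=> V [].
apply/seteqP; split=> x; first by move=> [V [_ VU] /VU].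
by move=> /US[V [SV Vx VU]]; exists V.
Qed.

Lemma generated_open_sub S U : S U -> generated_open S U.
Proof.
move=> SU; apply/generated_openP => x Ux; exists U; split=> //.
exact: (@finI_from1 _ _ _ id).
Qed.

Lemma generated_openT S : generated_open S setT.
Proof.
apply/generated_openP => x _; exists setT; split=> //.
by exists fset0 => //; rewrite set_fset0 bigcap_set0.
Qed.

Lemma generated_openI S : setI_closed (generated_open S).
Proof.
move=> U V /generated_openP US /generated_openP VS.
apply/generated_openP => x [/US[U' [SU U'x UU]] /VS[V' [SV V'x VV]]].
by exists (U' `&` V'); split; [exact: finI_fromI|split|exact: setISS].
Qed.

Lemma generated_open_bigU S (I : Type) (f : I -> set T) :
  (forall i, generated_open S (f i)) -> generated_open S (\bigcup_i f i).
Proof.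
move=> fS; apply/generated_openP => x [i _ fix_].
have /generated_openP/(_ _ fix_)[V [SV Vx Vf]] := fS i.
by exists V; split=> // y /Vf; exists i.
Qed.

Lemma generated_openS S S' : S `<=` S' -> generated_open S `<=` generated_open S'.
Proof.
move=> SS U /generated_openP US; apply/generated_openP => x /US[V [[D DS <-] Vx VU]].
exists (\bigcap_(i in [set` D]) id i); split=> //; exists D => //.
by move=> A /DS; rewrite !inE; exact: SS.
Qed.

End generated_open.

Lemma generated_open_open (T : topologicalType) (S : set (set T)) :
  S `<=` open -> generated_open S `<=` open.
Proof.
move=> So _ [F FS <-]; apply: bigcup_open => U /FS[D DS <-].
rewrite bigcap_fset big_seq; apply: big_ind => [||V /DS].
- exact: openT.
- exact: openI.
- by rewrite inE => /So.
Qed.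

(* HB refuses a structure inheriting from both topological spaces and
   meet-semilattices when the order topology of the library is loaded, hence a
   record, where the topology is passed as a factory. *)
Record topSemilattice d := TopSemilattice {
  ts_sort :> tMeetSemilatticeType d;
  ts_topology : isOpenTopological ts_sort }.

Definition space d (X : topSemilattice d) : topologicalType :=
  HB.pack_for topologicalType (Order.TMeetSemilattice.sort X) (ts_topology X).

Section topSemilattice.
Context {d : Order.disp_t}.
Implicit Types X : topSemilattice d.

Definition clopen_filter X : set (set X) :=
  [set a | clopen (a : set (space X)) /\ meet_filter a].

Definition clopen_prime_downset X : set (set X) :=
  [set b | clopen (b : set (space X)) /\ prime_downset b].

Definition closed_filter X : set (set X) :=
  [set c | meet_filter c /\
    c = \bigcap_(a in [set a | clopen_filter a /\ c `<=` a]) a].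

Definition stone_space (T : topologicalType) :=
  [/\ compact [set: T], hausdorff_space T & totally_disconnected [set: T]].

Definition mspace_axiom X :=
  stone_space (space X) /\
  @open (space X) =
    generated_open (@clopen_filter X `|` [set ~` a | a in @clopen_filter X]).

Definition ispace_axiom X :=
  forall a b : set X,
    clopen_filter a -> clopen_filter b -> clopen_filter (set_imp a b).

End topSemilattice.

Record mspaceType d := MSpaceType {
  mspace_ts :> topSemilattice d;
  mspaceP : mspace_axiom mspace_ts }.

Record ispaceType d := ISpaceType {
  ispace_mspace :> mspaceType d;
  ispaceP : ispace_axiom ispace_mspace }.

Lemma space_openE d (X : topSemilattice d) :
  @open (space X) = isOpenTopological.op (ts_topology X).
Proof. by []. Qed.

Section mspace_theory.
Context {d : Order.disp_t}.
Local Open Scope order_scope.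

Lemma clopen_filterT (X : topSemilattice d) : clopen_filter [set: X].
Proof. by split; [exact: (@clopenT (space X))|exact: meet_filterT]. Qed.

Lemma clopen_filterI (X : topSemilattice d) (a b : set X) :
  clopen_filter a -> clopen_filter b -> clopen_filter (a `&` b)%classic.
Proof.
move=> [ca fa] [cb fb]; split; last exact: meet_filterI.
exact: (@clopenI (space X)).
Qed.

Lemma clopen_prime_downsetC (X : topSemilattice d) (b : set X) :
  clopen_prime_downset b -> clopen_filter (~` b)%classic.
Proof.
move=> [cb pb]; split; last exact: prime_downsetC.
exact: (@clopenC (space X)).
Qed.

Lemma clopen_filter_preimage (X Y : topSemilattice d) (f : X -> Y) (a : set Y) :
  continuous (f : space X -> space Y) -> meet_hom f ->
  clopen_filter a -> clopen_filter (f @^-1` a).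
Proof.
move=> fc fh [ca fa]; split; last exact: meet_filter_preimage.
exact: (@clopen_comp (space X) (space Y)).
Qed.

Lemma clopen_prime_downset_preimage (X Y : topSemilattice d) (f : X -> Y)
    (b : set Y) :
  continuous (f : space X -> space Y) -> meet_hom f ->
  clopen_prime_downset b -> clopen_prime_downset (f @^-1` b).
Proof.
move=> fc fh [cb pb]; split; last exact: prime_downset_preimage.
exact: (@clopen_comp (space X) (space Y)).
Qed.

Variable X : mspaceType d.
Implicit Types (x y : X) (a c : set X) (F : set (set X)).

Lemma mspace_compact : compact [set: space X].
Proof. by case: (mspaceP X) => -[]. Qed.

Lemma mspace_hausdorff : hausdorff_space (space X).
Proof. by case: (mspaceP X) => -[]. Qed.

Lemma mspace_openE : @open (space X) =
  generated_open
    (@clopen_filter d X `|` [set ~` a | a in @clopen_filter d X])%classic.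
Proof. by case: (mspaceP X). Qed.

Lemma mspace_neq_sep x y : x <> y ->
  exists2 a, clopen_filter a & (a x /\ ~ a y) \/ (a y /\ ~ a x).
Proof.
move=> /eqP xy.
have := mspace_hausdorff; rewrite open_hausdorff => /(_ x y xy) [[U V]] /=.
rewrite !inE => -[Ux Vy] [Uo _ UV0].
move: Uo; rewrite mspace_openE => /generated_openP/(_ _ Ux)[W [[D DS <-] Wx WU]].
apply: contrapT => nsep.
have /WU Uy : (\bigcap_(i in [set` D]) id i) y.
  move=> A /= AD; have Ax := Wx _ AD; apply: contrapT => nAy; apply: nsep.
  have := DS _ AD; rewrite inE => -[cA|[a ca aA]].
    by exists A => //; left.
  exists a => //; right; split; last by move: Ax; rewrite -aA.
  by apply: contrapT => nay; apply: nAy; rewrite -aA.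
have UVy : (U `&` V)%classic y by [].
by move: UVy; rewrite UV0.
Qed.

Lemma mspace_sep x y : ~~ (x <= y) ->
  exists a, [/\ clopen_filter a, a x & ~ a y].
Proof.
move=> xy; have /mspace_neq_sep[a [ca fa]] : x <> x `&` y.
  by move=> e; move/negP: xy; apply; rewrite leEmeet -e.
have [_ aU aM] := fa.
case=> -[ax nay]; exists a; split=> //.
- by move=> ay; apply: nay; exact: aM.
- by case: nay; apply: aU ax; exact: leIl.
- by case: nay; apply: aU ax; exact: leIl.
Qed.

Lemma closed_filter_sep c x : meet_filter c -> closed (c : set (space X)) ->
  ~ c x -> exists a, [/\ clopen_filter a, c `<=` a & ~ a x].
Proof.
move=> fc cc ncx; have [_ cU cM] := fc; apply: contrapT => nsep.
pose tail z := [set y | c y /\ y <= z].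
have ctop := meet_filter_top fc.
have tF : ProperFilter (filter_from c tail).
  apply: filter_from_proper; last first.
    by move=> z cz; exists z; split.
  apply: filter_from_filter; first by exists \top.
  move=> y z cy cz; exists (y `&` z); first exact: cM.
  move=> w [cw]; rewrite lexI => /andP[wy wz].
  by split.
have [|p [_ pt]] := @mspace_compact _ tF.
  by exists \top.
have cp : c p.
  have -> : c = closure (c : set (space X)) by apply: (proj1 (@closure_id (space X) _)).
  by move=> U pU; apply: pt pU; exists \top => // y [].
have /mspace_sep[a [aC ap nax]] : ~~ (p <= x).
  by apply/negP => px; apply: ncx; exact: cU px cp.
have [z [cz naz]] : exists z, c z /\ ~ a z.
  apply: contrapT => nz; apply: nsep; exists a; split=> // z cz.
  by apply: contrapT => naz; apply: nz; exists z.
have [[aO _] [_ aU _]] := aC.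
have [||y [[_ yz] ay]] := pt (tail z) a.
- by exists z.
- exact: open_nbhs_nbhs.
- by apply: naz; exact: aU yz ay.
Qed.

(* The two readings of "closed filter" agree. *)
Lemma closed_filterE c :
  closed_filter c <-> meet_filter c /\ closed (c : set (space X)).
Proof.
split=> [[fc ->]|[fc cc]].
  split; first by apply: meet_filter_bigcap => a [[]].
  by apply: (@closed_bigI (space X)) => a [[[]]].
split=> //; apply/seteqP; split=> [x cx a [_]|x cx]; first exact.
apply: contrapT => /(closed_filter_sep fc cc)[a [ca sa]]; apply.
exact: (cx a).
Qed.

Lemma closed_filter_bigcap F : F `<=` @clopen_filter d X ->
  closed_filter (\bigcap_(a in F) a).
Proof.
move=> FC; apply/closed_filterE; split.
  by apply: meet_filter_bigcap => a /FC[].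
by apply: (@closed_bigI (space X)) => a /FC[[]].
Qed.

Lemma clopen_filter_closed a : clopen_filter a -> closed_filter a.
Proof. by move=> [[_ ca] fa]; apply/closed_filterE. Qed.

Lemma closed_filter1 : closed_filter [set \top : X].
Proof.
apply/closed_filterE; split; first exact: meet_filter1.
exact/accessible_closed_set1/hausdorff_accessible/mspace_hausdorff.
Qed.

Lemma bigcap_clopen_filter_sub F a : F `<=` @clopen_filter d X ->
  F setT -> setI_closed F -> clopen_filter a ->
  \bigcap_(b in F) b `<=` a -> exists2 b, F b & b `<=` a.
Proof.
move=> FC FT FI [[aO _] _] Fa; apply: contrapT => nb.
have FF : ProperFilter (filter_from F (fun b => b `\` a)).
  apply: filter_from_proper; last first.
    move=> b Fb; apply: contrapT => nba; apply: nb; exists b => // x bx.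
    by apply: contrapT => nax; apply: nba; exists x.
  apply: filter_from_filter; first by exists setT.
  move=> b b' Fb Fb'; exists (b `&` b')%classic; first exact: FI.
  by move=> x [[]].
have [|p [_ pF]] := @mspace_compact _ FF; first by exists setT.
have Fp b : F b -> (b `\` a) p.
  move=> Fb; have cba : closed (b `\` a : set (space X)).
    apply: (@closedI (space X)); first by have [[]] := FC _ Fb.
    exact: (@open_closedC (space X)).
  have -> : b `\` a = closure (b `\` a : set (space X)) by apply: (proj1 (@closure_id (space X) _)).
  by move=> U pU; apply: pF pU; exists b.
by have [_] := Fp _ FT; apply; apply: Fa => b /Fp[].
Qed.

End mspace_theory.

Record vietoris d (X : mspaceType d) := Vietoris {
  vset :> set X;
  vsetP : closed_filter vset }.

Lemma vset_inj d (X : mspaceType d) : injective (@vset d X).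
Proof.
by move=> [c cP] [c' c'P] /= cc'; rewrite -cc' in c'P *; congr Vietoris.
Qed.

HB.instance Definition _ d (X : mspaceType d) := gen_eqMixin (vietoris X).
HB.instance Definition _ d (X : mspaceType d) := gen_choiceMixin (vietoris X).

Section vietoris_order.
Context {d : Order.disp_t} {X : mspaceType d}.
Implicit Types (c : vietoris X).

Definition vietoris_le : rel (vietoris X) := fun c c' => `[< c' `<=` c >].

Fact vietoris_le_refl : reflexive vietoris_le.
Proof. by move=> c; apply/asboolP. Qed.

Fact vietoris_le_anti : antisymmetric vietoris_le.
Proof.
move=> c c' /andP[/asboolP cc' /asboolP c'c].
by apply: vset_inj; apply/seteqP.
Qed.

Fact vietoris_le_trans : transitive vietoris_le.
Proof.
move=> c2 c1 c3 /asboolP c21 /asboolP c32.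
by apply/asboolP; exact: subset_trans c21.
Qed.

HB.instance Definition _ := Order.Le_isPOrder.Build d (vietoris X)
  vietoris_le_refl vietoris_le_anti vietoris_le_trans.

Lemma vietoris_leP c c' : reflect (c' `<=` c) (c <= c')%O.
Proof. exact: asboolP. Qed.

Definition vietoris_top := Vietoris (@closed_filter1 d X).

Fact vietoris_lex1 c : (c <= vietoris_top)%O.
Proof. by apply/vietoris_leP => _ ->; apply: meet_filter_top; case: (vsetP c). Qed.

HB.instance Definition _ := @Order.hasTop.Build d (vietoris X)
  vietoris_top vietoris_lex1.

Fact vietoris_meetP c c' :
  closed_filter (\bigcap_(a in [set a | clopen_filter a /\ c `|` c' `<=` a]) a).
Proof. by apply: closed_filter_bigcap => a []. Qed.

Definition vietoris_meet c c' := Vietoris (vietoris_meetP c c').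

Fact vietoris_lexI c c1 c2 :
  (c <= vietoris_meet c1 c2)%O = (c <= c1)%O && (c <= c2)%O.
Proof.
apply/vietoris_leP/andP => [cc|[/vietoris_leP c1c /vietoris_leP c2c]].
  by split; apply/vietoris_leP => x cx; apply: cc => a [_]; apply; [left|right].
have [_ -> /=] := vsetP c; move=> x cx a [ca sa]; apply: cx; split=> //.
by move=> y [/c1c /sa|/c2c /sa].
Qed.

HB.instance Definition _ := @Order.POrder_isMeetSemilattice.Build d (vietoris X)
  vietoris_meet vietoris_lexI.

Definition vietoris_subbase : set (set (vietoris X)) :=
  [set [set c : vietoris X | c `<=` a] | a in @clopen_filter d X] `|`
  [set [set c : vietoris X | (c `&` b) !=set0] | b in @clopen_prime_downset d X].

Definition vietoris_topology : isOpenTopological (vietoris X) :=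
  isOpenTopological.Build (vietoris X) (@generated_openT _ vietoris_subbase)
    (@generated_openI _ vietoris_subbase)
    (@generated_open_bigU _ vietoris_subbase).

Definition vietoris_ts : topSemilattice d :=
  @TopSemilattice d (vietoris X) vietoris_topology.

End vietoris_order.

Arguments vietoris_ts {d} X.

Section vietoris_mspace.
Context {d : Order.disp_t} (X : mspaceType d).
Implicit Types (c : vietoris X) (a : set X).
Let VX := vietoris_ts X.

Lemma vietoris_box_clopen a : clopen_filter a ->
  clopen ([set c | c `<=` a] : set (space VX)).
Proof.
move=> ca; split; first by apply: generated_open_sub; left; exists a.
rewrite -openC; apply: generated_open_sub; right; exists (~` a).
  have [[ao ac] fa] := ca; split.
    by split; [exact: (@closed_openC (space X))|exact: (@open_closedC (space X))].
  have [_ aU aM] := fa; split.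
  - move=> e; have : (~` a) \top%O by rewrite e.
    by apply; exact: meet_filter_top.
  - by move=> x y xy nay ax; apply: nay; exact: aU xy ax.
  - move=> x y naxy; apply: contrapT => nxy; apply: naxy.
    by apply: aM; apply: contrapT => n; apply: nxy; [left|right].
apply/seteqP; split=> c; first by move=> [x [cx nax]] /(_ _ cx).
move=> nca; apply: contrapT => nc; apply: nca => x cx; apply: contrapT => nax.
by apply: nc; exists x.
Qed.

Lemma vietoris_diamondE (b : set X) :
  [set c : vietoris X | (c `&` b) !=set0] = ~` [set c : vietoris X | c `<=` ~` b].
Proof.
apply/seteqP; split=> c; first by move=> [x [cx bx]] /(_ _ cx).
move=> ncb; apply: contrapT => n; apply: ncb => x cx bx.
by apply: n; exists x.
Qed.

Lemma vietoris_box_clopen_filter a : clopen_filter a ->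
  @clopen_filter d VX [set c : vietoris X | c `<=` a].
Proof.
move=> ca; split; first exact: vietoris_box_clopen.
split.
- by exists \top%O => x /= ->; apply: meet_filter_top; case: ca.
- by move=> c c' /vietoris_leP cc' /(subset_trans cc').
- move=> c c' sc sc' x /= cx; apply: (cx a); split=> // y.
  by move=> [/sc|/sc'].
Qed.

Lemma vietoris_sep c c' : c != c' -> exists a, clopen_filter a /\
  ((c `<=` a /\ ~ c' `<=` a) \/ (c' `<=` a /\ ~ c `<=` a)).
Proof.
move=> /eqP cc'; apply: contrapT => nsep; apply: cc'; apply: vset_inj.
have [_ ->] := vsetP c; have [_ ->] := vsetP c'.
congr (\bigcap_(a in _) a); apply/seteqP; split=> a [ca sa]; split=> //.
  by apply: contrapT => sa'; apply: nsep; exists a; split=> //; left.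
by apply: contrapT => sa'; apply: nsep; exists a; split=> //; right.
Qed.

Lemma vietoris_zero_dimensional : zero_dimensional (space VX).
Proof.
move=> c c' /vietoris_sep[a [ca]].
have cl := vietoris_box_clopen ca.
case=> -[sa nsa]; first by exists [set c : vietoris X | c `<=` a].
exists (~` [set c : vietoris X | c `<=` a]); split=> //.
  exact: (@clopenC (space VX) _ setT cl).
Qed.

Lemma vietoris_compact : compact [set: space VX].
Proof.
rewrite compact_ultra => U UU _.
pose F := [set a | @clopen_filter d X a /\ U [set c : vietoris X | c `<=` a]].
have FC : F `<=` @clopen_filter d X by move=> a [].
have FT : F setT.
  by split; [exact: clopen_filterT|apply: filterS filterT => c _ x].
have FI : setI_closed F.
  move=> a b [ca Ua] [cb Ub]; split; first exact: clopen_filterI.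
  by apply: filterS (filterI Ua Ub) => c [ac bc] x cx; split; [exact: ac|exact: bc].
exists (Vietoris (closed_filter_bigcap FC)); split=> //.
move=> A [B [Bo Bc BA]].
apply: filterS BA _; move: Bo Bc.
move=> /generated_openP/[apply] -[V [[D DS <-] cV VB]].
apply: filterS VB _; apply: filter_bigI => S SD.
have := cV S SD; have := DS _ SD; rewrite inE => -[[a ca <-] /= Fa|[b cb <-]].
  have [a' [_ Ua'] aa'] := bigcap_clopen_filter_sub FC FT FI ca Fa.
  by apply: filterS Ua' => c /subset_trans; apply.
rewrite /= => -[x [Fx bx]].
have [Ub|] := @in_ultra_setVsetC _ U [set c : vietoris X | c `<=` ~` b] UU.
  suff /Fx : F (~` b) by [].
  by split=> //; exact: clopen_prime_downsetC.
by rewrite -vietoris_diamondE.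
Qed.

Lemma vietoris_mspaceP : mspace_axiom VX.
Proof.
have zd := vietoris_zero_dimensional.
split; first split.
- exact: vietoris_compact.
- rewrite open_hausdorff => x y /zd[A [[oA cA] Ax nAy]].
  exists (A, ~` A); rewrite ?inE //=; split=> //; first exact: closed_openC.
  by rewrite setICr.
- exact: zero_dimension_totally_disconnected.
apply/seteqP; split; last first.
  by apply: generated_open_open => A [[[]]|[a [[_ ac] _] <-]]//; exact: closed_openC.
apply: generated_openS => A [[a ca <-]|[b cb <-]].
  by left; exact: vietoris_box_clopen_filter.
right; rewrite vietoris_diamondE; exists [set c : vietoris X | c `<=` ~` b] => //.
by apply: vietoris_box_clopen_filter; exact: clopen_prime_downsetC.
Qed.

Definition vietoris_mspace : mspaceType d := MSpaceType vietoris_mspaceP.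

End vietoris_mspace.

Section MSpace.
Variable d : Order.disp_t.

Definition mspace_morphism (X Y : topSemilattice d) (f : X -> Y) :=
  continuous (f : space X -> space Y) /\ meet_hom f.

Definition ispace_morphism (X Y : topSemilattice d) (f : X -> Y) :=
  mspace_morphism f /\ bounded_hom f.

Fact mspace_morphism_id (X : topSemilattice d) : @mspace_morphism X X id.
Proof. by split; [move=> x; exact: cvg_id|exact: meet_hom_id]. Qed.

Fact mspace_morphism_comp (X Y Z : topSemilattice d) (g : Y -> Z) (f : X -> Y) :
  mspace_morphism g -> mspace_morphism f -> mspace_morphism (g \o f).
Proof.
move=> [gc gh] [fc fh]; split; last exact: meet_hom_comp.
by move=> x; apply: (@continuous_comp (space X) (space Y) (space Z)); [exact: fc|exact: gc].
Qed.

Fact ispace_morphism_id (X : topSemilattice d) : @ispace_morphism X X id.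
Proof. by split; [exact: mspace_morphism_id|exact: bounded_hom_id]. Qed.

Fact ispace_morphism_comp (X Y Z : topSemilattice d) (g : Y -> Z) (f : X -> Y) :
  ispace_morphism g -> ispace_morphism f -> ispace_morphism (g \o f).
Proof.
move=> [gm gb] [fm fb]; split; first exact: mspace_morphism_comp.
exact: bounded_hom_comp.
Qed.

Definition mspace_hom (X Y : mspaceType d) := {f : X -> Y | mspace_morphism f}.

Definition ispace_hom (X Y : ispaceType d) := {f : X -> Y | ispace_morphism f}.

Definition mspace_id (X : mspaceType d) : mspace_hom X X :=
  exist _ id (mspace_morphism_id X).

Definition ispace_id (X : ispaceType d) : ispace_hom X X :=
  exist _ id (ispace_morphism_id X).

Definition mspace_comp (X Y Z : mspaceType d)
    (g : mspace_hom Y Z) (f : mspace_hom X Y) : mspace_hom X Z :=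
  exist _ (sval g \o sval f) (mspace_morphism_comp (svalP g) (svalP f)).

Definition ispace_comp (X Y Z : ispaceType d)
    (g : ispace_hom Y Z) (f : ispace_hom X Y) : ispace_hom X Z :=
  exist _ (sval g \o sval f) (ispace_morphism_comp (svalP g) (svalP f)).

Definition MSpace : category.
Proof.
refine (@Category (mspaceType d) mspace_hom mspace_id mspace_comp _ _ _).
- by move=> X Y [f fP]; exact: eq_exist.
- by move=> X Y [f fP]; exact: eq_exist.
- by move=> X Y Z W h g f; exact: eq_exist.
Defined.

Definition ISpace : category.
Proof.
refine (@Category (ispaceType d) ispace_hom ispace_id ispace_comp _ _ _).
- by move=> X Y [f fP]; exact: eq_exist.
- by move=> X Y [f fP]; exact: eq_exist.
- by move=> X Y Z W h g f; exact: eq_exist.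
Defined.

Definition incl_hom (X Y : ispaceType d) (f : ispace_hom X Y) :
    mspace_hom X Y :=
  exist _ (sval f) (proj1 (svalP f)).

Definition functor_I : functor ISpace MSpace.
Proof.
refine (@Functor ISpace MSpace (fun X : ispaceType d => X : mspaceType d)
  incl_hom _ _).
- by move=> X; exact: eq_exist.
- by move=> X Y Z g f; exact: eq_exist.
Defined.

Section vietoris_map.
Variables (X Y : mspaceType d) (f : X -> Y) (fP : ispace_morphism f).

Fact vietoris_mapP (c : vietoris X) : closed_filter (f @` c).
Proof.
have [[fc fh] fb] := fP; have /closed_filterE[cF cC] := vsetP c.
apply/closed_filterE; split; first exact: meet_filter_image.
apply: compact_closed; first exact: mspace_hausdorff.
apply: (@continuous_compact (space X) (space Y)).
  exact: continuous_subspaceT.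
by apply: subclosed_compact cC (@mspace_compact _ X) _.
Qed.

Definition vietoris_map (c : vietoris X) : vietoris Y :=
  Vietoris (vietoris_mapP c).

Fact vietoris_map_morphism :
  @mspace_morphism (vietoris_ts X) (vietoris_ts Y) vietoris_map.
Proof.
have [[fc fh] fb] := fP; split.
  apply/(@continuousP (space (vietoris_ts X)) (space (vietoris_ts Y))) => A.
  move=> /generated_openP AO; rewrite openE => c /= /AO[V [[D DS <-] Vc VA]].
  apply: filterS (_ : _ `<=` vietoris_map @^-1` A) _.
    by move=> c'; apply: VA.
  apply: (@filter_bigI _ _ _ (fun i => vietoris_map @^-1` i)) => S SD.
  have Sc := Vc S SD.
  apply: open_nbhs_nbhs; split=> //.
  apply: generated_open_sub.
  have := DS _ SD; rewrite inE => -[[a ca <-]|[b cb <-]].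
    left; exists (f @^-1` a); first exact: clopen_filter_preimage.
    apply/seteqP; split=> c' s; first by move=> _ [x /s fx <-].
    by move=> x c'x; apply: s; exists x.
  right; exists (f @^-1` b); first exact: clopen_prime_downset_preimage.
  apply/seteqP; split=> c' [x].
    by move=> [c'x bfx]; exists (f x); split=> //; exists x.
  by move=> [[y c'y <-] bfy]; exists y.
split; first by apply: vset_inj; rewrite /= image_set1 fh.1.
move=> c c'; apply: vset_inj; apply/seteqP; split.
  move=> _ [x xcc <-] a [ca sa]; apply: (xcc (f @^-1` a)).
  split; first exact: clopen_filter_preimage.
  by move=> z [cz|cz]; apply: sa; [left|right]; exists z.
move=> y ycc; have [_ e] := vietoris_mapP (vietoris_meet c c').
change ((f @` vietoris_meet c c') y); rewrite e {e}.
move=> a [ca sa]; apply: ycc; split=> // _ [[x cx <-]|[x cx <-]]; apply: sa.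
  by exists x => // b [_]; apply; left.
by exists x => // b [_]; apply; right.
Qed.

Definition vietoris_hom :
    mspace_hom (vietoris_mspace X) (vietoris_mspace Y) :=
  exist _ vietoris_map vietoris_map_morphism.

End vietoris_map.

Definition functor_V : functor ISpace MSpace.
Proof.
refine (@Functor ISpace MSpace (fun X : ispaceType d => vietoris_mspace X)
  (fun (X Y : ispaceType d) (f : ispace_hom X Y) => vietoris_hom (svalP f)) _ _).
- move=> X; apply: eq_exist; apply/funext => c; apply: vset_inj.
  exact: image_id.
- move=> X Y Z g f; apply: eq_exist; apply/funext => c; apply: vset_inj.
  by rewrite /= image_comp.
Defined.

End MSpace.

Section box_frame.
Context {d : Order.disp_t} {L : tMeetSemilatticeType d}.
Implicit Types (R : L -> L -> Prop) (A : set (set L)) (p : set L).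
Local Open Scope order_scope.

Definition succs R (x : L) : set L := [set y | R x y].

Definition box R p : set L := [set x | succs R x `<=` p].

Record box_frame R : Prop := {
  box_frame_implicative : implicative L;
  box_frame_from_top : forall x, R \top x <-> x = \top;
  box_frame_to_top : forall x, R x \top;
  box_frame_le : forall x y z, R x y -> y <= z -> R x z;
  box_frame_meet : forall x y x' y',
    R x y -> R x' y' -> R (x `&` x') (y `&` y');
  box_frame_split : forall x x' z, R (x `&` x') z ->
    exists y y', [/\ R x y, R x' y' & y `&` y' = z] }.

Definition differentiated A :=
  forall x y, (forall a, A a -> a x -> a y) -> x <= y.

Definition compact_family A :=
  forall C, C `<=` (A `|` [set ~` a | a in A])%classic -> \bigcup_(U in C) U = setT ->
  exists D, [/\ finite_set D, D `<=` C & \bigcup_(U in D) U = setT].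

(* Closure under intersections includes the empty one. *)
Record descriptive_iframe A : Prop := {
  descriptive_implicative : implicative L;
  descriptive_filter : forall a, A a -> meet_filter a;
  descriptive_setT : A setT;
  descriptive_setI : setI_closed A;
  descriptive_imp : forall a b, A a -> A b -> A (set_imp a b);
  descriptive_differentiated : differentiated A;
  descriptive_compact : compact_family A }.

Record general_box_frame R A : Prop := {
  general_box : box_frame R;
  general_descriptive : descriptive_iframe A;
  general_closed : forall p, A p -> A (box R p) }.

Definition descriptive_box_frame R A :=
  general_box_frame R A /\
  forall x, succs R x = \bigcap_(a in [set a | A a /\ succs R x `<=` a]) a.

End box_frame.

Record descriptiveBoxFrame d := DescriptiveBoxFrame {
  dbf_sort :> tMeetSemilatticeType d;
  dbf_rel : dbf_sort -> dbf_sort -> Prop;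
  dbf_adm : set (set dbf_sort);
  dbfP : descriptive_box_frame dbf_rel dbf_adm }.

Section ISpaceBox.
Variable d : Order.disp_t.
Implicit Types X Y Z W : descriptiveBoxFrame d.

Record box_morphism X Y (h : X -> Y) : Prop := {
  box_morphism_meet : meet_hom h;
  box_morphism_bounded : bounded_hom h;
  box_morphism_rel : forall x y, dbf_rel x y -> dbf_rel (h x) (h y);
  box_morphism_back : forall x y', dbf_rel (h x) y' ->
    exists2 y, dbf_rel x y & h y = y';
  box_morphism_adm : forall a, dbf_adm a -> dbf_adm (h @^-1` a) }.

Fact box_morphism_id X : @box_morphism X X id.
Proof.
split=> //; first exact: bounded_hom_id.
by move=> x y; exists y.
Qed.

Fact box_morphism_comp X Y Z (g : Y -> Z) (f : X -> Y) :
  box_morphism g -> box_morphism f -> box_morphism (g \o f).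
Proof.
case=> gh gb gR gB gA [fh fb fR fB fA]; split.
- exact: meet_hom_comp.
- exact: bounded_hom_comp.
- by move=> x y /fR/gR.
- by move=> x z /gB[y /fB[w xw <-] <-]; exists w.
- by move=> a /gA/fA.
Qed.

Definition box_hom X Y := {h : X -> Y | box_morphism h}.

Definition box_id X : box_hom X X := exist _ id (box_morphism_id X).

Definition box_comp X Y Z (g : box_hom Y Z) (f : box_hom X Y) : box_hom X Z :=
  exist _ (sval g \o sval f) (box_morphism_comp (svalP g) (svalP f)).

Definition ISpaceBox : category.
Proof.
refine (@Category (descriptiveBoxFrame d) box_hom box_id box_comp _ _ _).
- by move=> X Y [f fP]; exact: eq_exist.
- by move=> X Y [f fP]; exact: eq_exist.
- by move=> X Y Z W h g f; exact: eq_exist.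
Defined.

End ISpaceBox.

(* Main.v *)
Require Import Defs.
From mathcomp Require Import all_boot all_order.
From mathcomp Require Import finmap all_classical topology.

(* A descriptive box-frame (X, <=, R, A) corresponds to the I-space on X whose
   topology is generated by A and the complements of members of A, with the map
   x |-> R[x]; conversely a dialgebra g yields R := {(x, y) | y in g x} and the
   set A of clopen filters.  Compactness gives every closed filter a least
   element.  This implies that A is recovered as the set of clopen filters, that
   an I-space is implicative, being the set of filters of an implicative
   semilattice, and that condition (B4) holds, as it says that the meet of two
   principal filters is computed elementwise. *)

Set Implicit Arguments.
Unset Strict Implicit.
Unset Printing Implicit Defensive.

Import Order.TTheory.

Local Open Scope classical_set_scope.

(** * Distributivity of implicative semilattices *)

Section distributivity.
Context {d : Order.disp_t} {L : tMeetSemilatticeType d}.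
Local Open Scope order_scope.

(** Take [y] as the implication from [q] to [z] and [y'] as that from [y] to [z]: both lie above
    [z], and modus ponens bounds their meet by [z]. *)
Lemma implicative_split (p q z : L) : implicative L -> p `&` q <= z ->
  exists y y', [/\ p <= y, q <= y' & y `&` y' = z].
Proof.
move=> imp pqz; have [y yP] := imp q z; have [y' y'P] := imp y z.
exists y, y'; split; first by rewrite yP.
  by rewrite y'P meetC -yP.
apply/le_anti; rewrite meetC -y'P lexx lexI yP y'P.
by rewrite !leIl.
Qed.

End distributivity.

(** * Least elements of closed filters *)

Section mspace_least.
Context {d : Order.disp_t} {X : mspaceType d}.
Implicit Types (c : set X) (F : set (set X)).
Local Open Scope order_scope.

(** The tails of [c] are directed because [c] is closed under meets, so by compactness they have a
    cluster point. It lies in [c], which is closed, and no clopen filter contains it while missing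
    an element of [c]. *)
Lemma closed_filter_least c : closed_filter c ->
  exists2 p, c p & forall z, c z -> p <= z.
Proof.
move=> /closed_filterE[fc cc]; have [_ cU cM] := fc.
have ctop := meet_filter_top fc.
pose tail z := [set y | c y /\ y <= z].
have tF : ProperFilter (filter_from c tail).
  apply: filter_from_proper; last by move=> z cz; exists z.
  apply: filter_from_filter; first by exists \top.
  move=> y z cy cz; exists (y `&` z); first exact: cM.
  by move=> w [cw]; rewrite lexI => /andP[wy wz].
have [|p [_ pt]] := @mspace_compact _ X _ tF; first by exists \top.
exists p.
  have -> : c = closure (c : set (space X)).
    by apply: (proj1 (@closure_id (space X) _)).
  by move=> U pU; apply: pt pU; exists \top => // y [].
move=> z cz; apply: contrapT => /negP/mspace_sep[a [[[aO _] [_ aU _]] ap naz]].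
have [||y [[_ yz] ay]] := pt (tail z) a; first by exists z.
  exact: open_nbhs_nbhs.
by apply: naz; exact: aU yz ay.
Qed.

(** The point is the least element of the intersection of [F]: a clopen filter containing it
    contains that intersection, hence, by compactness, a member of [F]. *)
Lemma clopen_filter_system_point F : F `<=` @clopen_filter d X ->
  F setT -> setI_closed F ->
  (forall a b, F a -> clopen_filter b -> a `<=` b -> F b) ->
  exists p : X, forall a, clopen_filter a -> (a p <-> F a).
Proof.
move=> FC FT FI FU.
have [p Fp pmin] := closed_filter_least (closed_filter_bigcap FC).
exists p => a ca; split=> [ap|/Fp//].
have [|b Fb ba] := bigcap_clopen_filter_sub FC FT FI ca; last exact: FU Fb ca ba.
by move=> z /pmin pz; have [_ [_ aU _]] := ca; exact: aU pz ap.
Qed.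

(* X is the set of filters of the implicative semilattice of its clopen
   filters, where the implication of filters x, y consists of the a such that
   any c above a which belongs to x belongs to y. *)
Lemma ispace_implicative : ispace_axiom X -> implicative X.
Proof.
move=> impX x y.
pose F := [set a : set X | clopen_filter a /\
  forall c, clopen_filter c -> a `<=` c -> c x -> c y].
have [||||z zF] := @clopen_filter_system_point F.
- by move=> a [].
- split=> [|c [_ [_ _ _]] sc _]; [exact: clopen_filterT|exact: sc].
- move=> a b [ca aF] [cb bF]; split=> [|c cc abc cx]; first exact: clopen_filterI.
  have [_ [_ cU cM]] := cc; have [_ [_ aU aM]] := ca; have [_ [_ bU bM]] := cb.
  (* As [b] is included in [set_imp a c], the latter contains [y]. As [a] is included in
     [set_imp (set_imp a c) c], that contains [y] too, and evaluating it at [y] gives [c y]. *)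
  have cac := impX _ _ ca cc; have cacc := impX _ _ cac cc.
  have acy : set_imp a c y.
    apply: bF => // [w bw v wv av|w xw aw]; last exact: cU xw cx.
    by apply: abc; split=> //; exact: bU wv bw.
  apply: (aF _ cacc _ _ _ (lexx y) acy) => [w aw v wv|w xw _]; last exact: cU xw cx.
  by move=> /(_ _ (lexx v)); apply; exact: aU wv aw.
- by move=> a b [ca aF] cb ab; split=> // c cc /(subset_trans ab); exact: aF.
exists z => w; apply/idP/idP => [wz|wxy]; apply: contrapT => /negP/mspace_sep[a [ca]].
  move=> awx nay; have [_ [_ aU aM]] := ca; apply: nay.
  have /(zF _ ca)[_] : a z by exact: aU wz (aU _ _ (leIl _ _) awx).
  by apply=> //; exact: aU _ _ (leIr _ _) awx.
move=> aw; apply; apply/(zF _ ca); split=> // c cc ac cx.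
have [_ [_ cU cM]] := cc; apply: (cU _ _ wxy); apply: cM => //; exact: ac.
Qed.

(** A clopen filter containing the meet of the least elements [p] and [q] contains [c] and [c'],
    hence [z]. So this meet is below [z], and distributivity splits [z]. *)
Lemma vietoris_meet_split (c c' : vietoris X) z : implicative X ->
  vset (vietoris_meet c c') z ->
  exists y y', [/\ vset c y, vset c' y' & y `&` y' = z].
Proof.
move=> imp cz.
have [p cp pmin] := closed_filter_least (vsetP c).
have [q cq qmin] := closed_filter_least (vsetP c').
have [|y [y' [py qy' yz]]] := implicative_split (p := p) (q := q) (z := z) imp.
  apply: contrapT => /negP/mspace_sep[a [ca apq]]; apply; apply: cz.
  split=> //; have [_ [_ aU _]] := ca.
  move=> w [/pmin|/qmin] le; apply: aU apq; apply: le_trans le; [exact: leIl|exact: leIr].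
exists y, y'; split=> //.
  by have [[_ cU _] _] := vsetP c; exact: cU py cp.
by have [[_ cU _] _] := vsetP c'; exact: cU qy' cq.
Qed.

End mspace_least.

Lemma continuous_generated d (X Y : topSemilattice d) (S : set (set Y))
    (f : X -> Y) : @open (space Y) = generated_open S ->
  (forall U, S U -> open (f @^-1` U : set (space X))) ->
  continuous (f : space X -> space Y).
Proof.
move=> YS fS; apply/(@continuousP (space X) (space Y)) => V.
rewrite YS => /generated_openP VO; rewrite openE => x /= /VO[W [[D DS WE] Wx WV]].
apply: (@filterS _ (nbhs (x : space X)) _ (f @^-1` W)); first by move=> x' /WV.
rewrite -WE in Wx *; apply: (@filter_bigI _ _ _ (fun i => f @^-1` i)) => U UD.
apply: open_nbhs_nbhs; split; last exact: Wx.
by apply: fS; have := DS _ UD; rewrite inE.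
Qed.

(** * I-spaces and descriptive I-frames *)

Section admissible_space.
Context {d : Order.disp_t} {L : tMeetSemilatticeType d} (A : set (set L)).
Local Open Scope order_scope.

Definition adm_subbase : set (set L) := (A `|` [set ~` a | a in A])%classic.

Definition adm_topology : isOpenTopological L :=
  isOpenTopological.Build L (@generated_openT _ adm_subbase)
    (@generated_openI _ adm_subbase) (@generated_open_bigU _ adm_subbase).

Definition adm_ts : topSemilattice d := TopSemilattice adm_topology.

Lemma adm_clopen a : A a -> clopen (a : set (space adm_ts)).
Proof.
move=> Aa; split; first by apply: generated_open_sub; left.
by rewrite -openC; apply: generated_open_sub; right; exists a.
Qed.

(** This is Alexander's subbase argument: if an ultrafilter has no limit, the subbasic sets outside
    it cover the space, and a finite subcover puts the empty set in it. *)
Lemma adm_topology_compact : compact_family A -> compact [set: space adm_ts].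
Proof.
move=> Ac; rewrite compact_ultra => U UU _; apply: contrapT => nU.
have [V []//||D [/finite_fsetP[E ->] DC DT]] := Ac [set V | adm_subbase V /\ ~ U V].
  apply/seteqP; split=> // x _; apply: contrapT => nCx; apply: nU.
  exists x; split=> // V [B [Bo Bx BV]].
  apply: filterS BV _; move: Bo Bx => /generated_openP/[apply].
  move=> [W [[E ES <-] Wx WB]]; apply: filterS WB _; apply: filter_bigI => S SE.
  apply: contrapT => nUS; apply: nCx; exists S; last exact: Wx.
  by split=> //; have := ES _ SE; rewrite inE.
have : U (\bigcap_(V in [set` E]) ~` V).
  apply: filter_bigI => V /DC[_ nUV].
  by have [] := @in_ultra_setVsetC _ U V UU.
by rewrite -setC_bigcup DT setCT; exact: filter_not_empty.
Qed.

Hypothesis AP : descriptive_iframe A.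

Lemma adm_subset_clopen_filter : A `<=` @clopen_filter d adm_ts.
Proof.
by move=> a Aa; split; [exact: adm_clopen|exact: descriptive_filter Aa].
Qed.

Lemma adm_zero_dimensional : zero_dimensional (space adm_ts).
Proof.
move=> x y xy; have [a [Aa]] : exists a, A a /\ (a x <> a y).
  apply: contrapT => nsep; move/eqP: xy; apply.
  have sep a : A a -> a x = a y.
    by move=> Aa; apply: contrapT => axy; apply: nsep; exists a.
  apply: le_anti; apply/andP; split; apply: (descriptive_differentiated AP) => a Aa.
    by rewrite sep.
  by rewrite -sep.
have ca := adm_clopen Aa.
move=> axy; have [ax|nax] := pselect (a x).
  by exists a; split=> // ay; apply: axy; exact/propext.
exists (~` a); split; [exact: (@clopenC (space adm_ts))|exact: nax|].
by move=> nnay; apply: axy; apply/propext; split=> // _; exact: contrapT nnay.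
Qed.

Lemma adm_mspaceP : mspace_axiom adm_ts.
Proof.
have zd := adm_zero_dimensional; split; first split.
- exact: adm_topology_compact (descriptive_compact AP).
- rewrite open_hausdorff => x y /zd[V [[oV cV] Vx nVy]].
  exists (V, ~` V); rewrite ?inE //=; split=> //; first exact: closed_openC.
  by rewrite setICr.
- exact: zero_dimension_totally_disconnected.
apply/seteqP; split; last first.
  by apply: generated_open_open => V [[[]]|[a [[_ ac] _] <-]]//; exact: closed_openC.
apply: generated_openS => V [/adm_subset_clopen_filter|[a /adm_subset_clopen_filter ca <-]].
  by left.
by right; exists a.
Qed.

Definition adm_mspace : mspaceType d := MSpaceType adm_mspaceP.

(** A clopen filter [a] is the intersection of the admissible sets above it: differentiation puts
    every point of that intersection above the least element of [a]. By compactness one of these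
    sets is already included in [a]. *)
Lemma adm_clopen_filterE : @clopen_filter d adm_ts = A.
Proof.
apply/seteqP; split=> [a ca|]; last exact: adm_subset_clopen_filter.
pose F := [set b | A b /\ a `<=` b].
have [||||b [Ab ab] ba] := @bigcap_clopen_filter_sub d adm_mspace F a _ _ _ ca _.
- by move=> b [/adm_subset_clopen_filter].
- by split=> //; exact: descriptive_setT.
- move=> b c [Ab ab] [Ac ac]; split; first exact: (descriptive_setI AP).
  by move=> x ax; split; [exact: ab|exact: ac].
- have [p ap pmin] := closed_filter_least (@clopen_filter_closed d adm_mspace _ ca).
  have [_ [_ aU _]] := ca.
  move=> x Fx; apply: aU ap; apply: (descriptive_differentiated AP) => b Ab bp.
  apply: Fx; split=> // z /pmin pz.
  by have [_ bU _] := descriptive_filter AP Ab; exact: bU pz bp.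
by have -> : a = b by apply/seteqP.
Qed.

Lemma adm_ispaceP : ispace_axiom adm_ts.
Proof. by rewrite /ispace_axiom adm_clopen_filterE; exact: descriptive_imp. Qed.

Definition adm_ispace : ispaceType d := @ISpaceType d adm_mspace adm_ispaceP.

End admissible_space.

Lemma ispace_descriptive_iframe d (X : ispaceType d) :
  descriptive_iframe (@clopen_filter d X).
Proof.
split.
- exact/ispace_implicative/ispaceP.
- by move=> a [].
- exact: clopen_filterT.
- by move=> a b; exact: clopen_filterI.
- exact: ispaceP.
- move=> x y sep; apply: contrapT => /negP/mspace_sep[a [ca ax]]; apply.
  exact: sep.
(* Without a finite subcover, the complements of finite unions generate a proper filter; its cluster
   point would avoid every member of [C]. *)
move=> C CA CT; apply: contrapT => nfin.
pose S := [set D | finite_set D /\ D `<=` C].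
have FF : ProperFilter (filter_from S (fun D => ~` \bigcup_(V in D) V)).
  apply: filter_from_proper; last first.
    move=> D [fD DC]; apply: contrapT => nD; apply: nfin; exists D; split=> //.
    apply/seteqP; split=> // x _; apply: contrapT => nx; apply: nD.
    by exists x.
  apply: filter_from_filter; first by exists set0; split.
  move=> D E [fD DC] [fE EC]; exists (D `|` E).
    by split; [rewrite finite_setU|move=> V [/DC|/EC]].
  by move=> x nx; split=> -[V ? ?]; apply: nx; exists V => //; [left|right].
have [|p [_ pF]] := @mspace_compact _ X _ FF.
  by exists set0; split.
have [V CV Vp] : (\bigcup_(V in C) V) p by rewrite CT.
have Vo : open (V : set (space X)).
  by case: (CA V CV) => [[[]]|[a [[_ ac] _] <-]] //; exact: closed_openC.
have [||x [nx Vx]] := pF (~` \bigcup_(W in [set V]) W) V.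
- by exists [set V] => //; split=> [|W ->//]; exact: finite_set1.
- exact: open_nbhs_nbhs.
by apply: nx; exists V.
Qed.

(** * From dialgebras to box-frames *)

Section box_of_dialgebra.
Context {d : Order.disp_t} (X : ispaceType d).
Variable g : mspace_hom X (vietoris_mspace X).
Local Open Scope order_scope.

Definition dialg_rel (x y : X) : Prop := vset (sval g x) y.

Lemma dialg_box_frame : box_frame dialg_rel.
Proof.
have imp := ispace_implicative (@ispaceP d X).
have [_ [gT gI]] := svalP g; split=> //; rewrite /dialg_rel.
- by move=> x; rewrite gT.
- by move=> x; have [/meet_filter_top] := vsetP (sval g x).
- by move=> x y z; have [[_ gU _] _] := vsetP (sval g x) => gy /gU; apply.
(* Preservation of meets by [g] gives (B3), and then (B4) by splitting elements of a Vietoris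
   meet. *)
- move=> x y x' y' gy gy'; rewrite (gI x x' : _ = vietoris_meet _ _).
  move=> a [[_ [_ _ aM]] sa].
  by apply: aM; apply: sa; [left|right].
- by move=> x x' z; rewrite (gI x x' : _ = vietoris_meet _ _) => /(vietoris_meet_split imp).
Qed.

Lemma dialg_descriptive_box_frame :
  descriptive_box_frame dialg_rel (@clopen_filter d X).
Proof.
have [gc gh] := svalP g; split; last by move=> x; have [_] := vsetP (sval g x).
split; first exact: dialg_box_frame.
  exact: ispace_descriptive_iframe.
move=> a ca.
(* [box dialg_rel a] is the preimage under [g] of the clopen filter of all closed filters included
   in [a]. *)
exact: (clopen_filter_preimage gc gh (vietoris_box_clopen_filter ca)).
Qed.

Definition dialg_box : descriptiveBoxFrame d :=
  DescriptiveBoxFrame dialg_descriptive_box_frame.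

End box_of_dialgebra.

(** * From box-frames to dialgebras *)

Section dialgebra_of_box.
Context {d : Order.disp_t} (Y : descriptiveBoxFrame d).
Local Open Scope order_scope.

Let YA : descriptive_iframe (@dbf_adm d Y).
Proof. by have [[]] := dbfP Y. Qed.

Definition box_ispace : ispaceType d := adm_ispace YA.

Lemma box_ispace_clopen_filterE : @clopen_filter d box_ispace = @dbf_adm d Y.
Proof. exact: adm_clopen_filterE. Qed.

(** Descriptivity is closedness once clopen filters are known to be the admissible sets; closure
    under meets is (B3) applied to [x] with itself. *)
Lemma box_succs_closed_filter (x : Y) :
  @closed_filter d box_ispace (succs (@dbf_rel d Y) x).
Proof.
have [[[_ _ RT RU RM _] _ _] Rcl] := dbfP Y.
split; last by rewrite box_ispace_clopen_filterE.
split; first by exists \top; exact: RT.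
  by move=> y z yz xy; exact: RU xy yz.
by move=> y z xy xz; rewrite -[x]meetxx; exact: RM.
Qed.

Definition box_str (x : box_ispace) : vietoris box_ispace :=
  Vietoris (box_succs_closed_filter x).

Lemma box_str_morphism :
  @mspace_morphism d box_ispace (vietoris_mspace box_ispace) box_str.
Proof.
have [[[_ R1 RT _ RM RS] _ Rbox] _] := dbfP Y.
split.
  have Rclopen a : @clopen_filter d box_ispace a ->
      clopen (box_str @^-1` [set c | vset c `<=` a] : set (space box_ispace)).
    by rewrite box_ispace_clopen_filterE => /Rbox /adm_clopen.
  apply: (@continuous_generated d box_ispace (vietoris_ts box_ispace)
    (@vietoris_subbase d box_ispace)) => //.
  move=> _ [[a ca <-]|[b cb <-]]; first by have [] := Rclopen a ca.
  (* A diamond of [b] is the complement of the box of the clopen filter complementary to [b], so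
     clopen preimages of boxes suffice. *)
  rewrite vietoris_diamondE preimage_setC.
  apply: (@closed_openC (space box_ispace)).
  by have [] := Rclopen _ (clopen_prime_downsetC cb).
split; first by apply: vset_inj; apply/seteqP; split=> x /R1.
move=> x x'; rewrite -[RHS]/(vietoris_meet (box_str x) (box_str x')).
apply: vset_inj; apply/seteqP; split=> z.
  move=> /RS[y [y' [xy xy' <-]]] a [[_ [_ _ aM]] sa].
  by apply: aM; apply: sa; [left|right].
have [_ e] := vsetP (box_str (x `&` x')); move=> zm.
change (vset (box_str (x `&` x')) z); rewrite e {e} => a [ca sa].
(* By (B3), a successor of [x] met with the successor [\top] of [x'] is a successor of the meet of
   [x] and [x']; the same holds with [x] and [x'] exchanged. *)
apply: zm; split=> // y [xy|xy]; apply: sa.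
  by rewrite -[y]meetx1; exact: RM.
by rewrite -[y]meet1x; exact: RM.
Qed.

Definition box_dialg : Dialg (functor_I d) (functor_V d) :=
  @Dialgebra _ _ (functor_I d) (functor_V d) box_ispace
    (exist _ box_str box_str_morphism).

End dialgebra_of_box.

(** * The two functors *)

Section functors.
Variable d : Order.disp_t.
Notation IV := (Dialg (functor_I d) (functor_V d)).

Definition obj_box (X : IV) : ISpaceBox d :=
  @dialg_box d (dialg_obj X) (dialg_str X).

(** Commutation with the structure maps says that [f] sends the successors of [x] onto those of
    [f x]; the two inclusions are the forth and back conditions. *)
Lemma dialg_hom_box_morphism (X X' : IV) (f : hom X X') :
  @box_morphism d (obj_box X) (obj_box X') (sval (sval f)).
Proof.
case: X X' f => [X g] [X' g'] [[f fP] /= /(congr1 sval)/= fg] /=.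
have [[fc fh] fb] := fP.
have fgE x : f @` vset (sval g x) = vset (sval g' (f x)).
  by have := congr1 (fun h => vset (h x)) fg.
split=> //=; rewrite /dialg_rel.
- by move=> x y gxy; rewrite -fgE; exists y.
- by move=> x y'; rewrite -fgE => -[y]; exists y.
- by move=> a; exact: clopen_filter_preimage.
Qed.

Definition functor_box : functor IV (ISpaceBox d).
Proof.
refine (@Functor IV (ISpaceBox d) obj_box
  (fun X X' f => exist _ _ (dialg_hom_box_morphism f)) _ _).
- by move=> X; exact: eq_exist.
- by move=> X Y Z g f; exact: eq_exist.
Defined.

Lemma box_hom_ispace_morphism (Y Y' : ISpaceBox d) (h : hom Y Y') :
  @ispace_morphism d (box_ispace Y) (box_ispace Y') (sval h).
Proof.
case: h => [h [hh hb _ _ hA]] /=; split=> //; split=> //.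
apply: (@continuous_generated d (box_ispace Y) (box_ispace Y')
  (adm_subbase (@dbf_adm d Y'))) => //.
move=> U [/hA/adm_clopen[]//|[a /hA/adm_clopen[_ ca] <-]].
by rewrite preimage_setC; exact: (@closed_openC (space (box_ispace Y))).
Qed.

Definition box_hom_ispace (Y Y' : ISpaceBox d) (h : hom Y Y') :
    @hom (ISpace d) (box_ispace Y) (box_ispace Y') :=
  exist _ _ (box_hom_ispace_morphism h).

Lemma box_hom_dialgP (Y Y' : ISpaceBox d) (h : hom Y Y') :
  compm (Defs.fmap (functor_V d) (box_hom_ispace h)) (dialg_str (box_dialg Y))
  = compm (dialg_str (box_dialg Y')) (Defs.fmap (functor_I d) (box_hom_ispace h)).
Proof.
apply: eq_exist; apply/funext => x; apply: vset_inj.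
case: h => [h [_ _ hR hB _]] /=; apply/seteqP; split.
  by move=> _ [y xy <-]; exact: hR.
by move=> y' /hB[y xy <-]; exists y.
Qed.

Definition functor_dialg : functor (ISpaceBox d) IV.
Proof.
refine (@Functor (ISpaceBox d) IV (@box_dialg d)
  (fun Y Y' h => exist _ (box_hom_ispace h) (box_hom_dialgP h)) _ _).
- by move=> X; apply: eq_exist; exact: eq_exist.
- by move=> X Y Z g f; apply: eq_exist; exact: eq_exist.
Defined.

End functors.

(** * Equality of the composites with the identity functors *)

(* Pairing F X with the map i X keeps track of the carrier of F X, so that no
   transport of morphisms along F X = X is needed. *)
Lemma functor_eq_id (C : category) (U : C -> Type)
    (u : forall X Y : C, hom X Y -> U X -> U Y) (F : functor C C)
    (i : forall X, U (F X) -> U X) :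
  (forall X Y, injective (u X Y)) ->
  (forall X, existT (fun Y => U Y -> U X) (F X) (i X) = existT _ X id) ->
  (forall X Y (f : hom X Y), i Y \o u _ _ (Defs.fmap F f) = u _ _ f \o i X) ->
  F = functor_id C.
Proof.
case: F i => [o m m1 mM] /= i uI oi mi.
have oE : o = id by apply/funext => X; exact: (congr1 (@projT1 _ _) (oi X)).
subst o.
have iE X : i X = id.
  (* The transport here is along a proof of [X = X], which proof irrelevance turns into [erefl]. *)
  have := projT2_eq (oi X).
  by rewrite (Prop_irrelevance (projT1_eq (oi X)) erefl).
have mE : m = fun _ _ f => f.
  apply: functional_extensionality_dep => X.
  apply: functional_extensionality_dep => Y.
  by apply/funext => f; apply: uI; have := mi _ _ f; rewrite !iE.
subst m; rewrite /functor_id.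
by congr Functor; exact: Prop_irrelevance.
Qed.

Lemma dbf_eq_carrier d (L : tMeetSemilatticeType d) (R R' : L -> L -> Prop)
    (A A' : set (set L)) (P : descriptive_box_frame R A)
    (P' : descriptive_box_frame R' A') : R = R' -> A = A' ->
  existT (fun Y : descriptiveBoxFrame d => Y -> L) (DescriptiveBoxFrame P) id
  = existT _ (DescriptiveBoxFrame P') id.
Proof.
by move=> RR AA; subst R' A'; rewrite (Prop_irrelevance P P').
Qed.

Lemma isOpenTopological_eq d (L : tMeetSemilatticeType d)
    (t t' : isOpenTopological L) :
  isOpenTopological.op t = isOpenTopological.op t' -> t = t'.
Proof.
case: t t' => [o oT oI oU] [o' oT' oI' oU'] /= oo'; subst o'.
by congr isOpenTopological.Axioms_; exact: Prop_irrelevance.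
Qed.

(** The types of [g] and [g'] depend on the topologies, so their values are compared as subsets of
    the common carrier [L]. *)
Lemma dialg_eq_carrier d (L : tMeetSemilatticeType d) (t t' : isOpenTopological L)
    (m : mspace_axiom (TopSemilattice t)) (m' : mspace_axiom (TopSemilattice t'))
    (p : @ispace_axiom d (MSpaceType m)) (p' : @ispace_axiom d (MSpaceType m'))
    (g : mspace_hom (MSpaceType m) (vietoris_mspace (MSpaceType m)))
    (g' : mspace_hom (MSpaceType m') (vietoris_mspace (MSpaceType m'))) :
  t = t' -> (forall x, vset (sval g x) = vset (sval g' x)) ->
  existT (fun X : Dialg (functor_I d) (functor_V d) => dialg_obj X -> L)
    (@Dialgebra _ _ (functor_I d) (functor_V d) (@ISpaceType d (MSpaceType m) p) g) id
  = existT _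
    (@Dialgebra _ _ (functor_I d) (functor_V d) (@ISpaceType d (MSpaceType m') p') g') id.
Proof.
move=> tt; subst t'; have mm := Prop_irrelevance m m'; subst m'.
have pp := Prop_irrelevance p p'; subst p' => gg.
suff -> : g = g' by [].
case: g g' gg => [g gP] [g' gP'] /= gg; apply: eq_exist; apply/funext => x.
exact/vset_inj/gg.
Qed.

Theorem theorem5p5 (d : Order.disp_t) :
  isomorphic_categories (ISpaceBox d) (Dialg (functor_I d) (functor_V d)).
Proof.
exists (functor_dialg d), (functor_box d); split.
- apply: (@functor_eq_id (ISpaceBox d) (@dbf_sort d) (fun _ _ h => sval h)
    (functor_comp (functor_box d) (functor_dialg d)) (fun _ => id)) => //.
    by move=> X Y [f fP] [f' fP'] /= ff; exact: eq_exist.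
  case=> L R A P; apply: dbf_eq_carrier; first by [].
  exact: (box_ispace_clopen_filterE (DescriptiveBoxFrame P)).
- apply: (@functor_eq_id (Dialg (functor_I d) (functor_V d))
    (fun X => ispace_mspace (dialg_obj X)) (fun _ _ h => sval (sval h))
    (functor_comp (functor_dialg d) (functor_box d)) (fun _ => id)) => //.
    move=> X Y [[f fP] fg] [[f' fP'] fg'] /= ff; apply: eq_exist.
    exact: eq_exist.
  case=> -[[[L t] m] p] g; apply: dialg_eq_carrier => //.
  (* The M-space axiom says that the original topology is the one generated by the clopen filters
     and their complements. *)
  by apply: isOpenTopological_eq; have [_ /esym] := m.
Qed.
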